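(* Let $k \in \mathbb{N} \cup \{0\} \cup \{\infty\}$, let $M$ be a finite dimensional $C^k$-manifold, let $\mathbb{K} \in \{\mathbb{R}, \mathbb{C}\}$, and let $E \subset C^k(M)$ be a rich subspace. Let $a : M \to \mathbb{R}_{>0}$ be a function and assume that $T : E \to E$ is a bijective operator such that for all $f, g \in E$ and all $x \in M$ $$| T(f \cdot g)(x) - Tf(x) \cdot Tg(x) | \le a(x).$$ Then $$T(f \cdot g) = Tf \cdot Tg \quad \text{for all } f, g \in E.$$
   Context: $C^k(M)$ denotes the space of $k$-times continuously differentiable functions $f : M \to \mathbb{K}$, where $\mathbb{K} \in \{\mathbb{R}, \mathbb{C}\}$; for $k=0$, $M$ is just a (topological) manifold and $C^0(M) = C(M)$ is the space of continuous functions. A linear subspace $E \subset C^k(M)$ is called rich if (i) $f, g \in E$ always implies $f \cdot g \in E$ (pointwise product), and (ii) for all $x \in M$ and all $r > 0$ there is $h \in E$ with $|h(x)| > r$. An operator $T$ is simply a map; it is not assumed to be linear or continuous. The function $a$ is an arbitrary positive function (no continuity assumed). *)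

(* Defs.v *)
From HB Require Import structures.
From mathcomp Require Import all_boot all_order all_algebra.
From mathcomp Require Import complex.
From mathcomp Require Import all_classical all_reals all_analysis.

Set Implicit Arguments.
Unset Strict Implicit.
Unset Printing Implicit Defensive.
Import Order.TTheory GRing.Theory Num.Theory.
Import numFieldNormedType.Exports.
Local Open Scope classical_set_scope.
Local Open Scope ring_scope.

(* [Rcomplex R] is R[i] as a vector space over R with the R-valued modulus as
   norm. The topology of this norm makes it a normed module over R, which gives
   complex-valued functions of real variables their directional derivatives. *)
HB.instance Definition _ (R : realType) :=
  PseudoMetric.copy (Rcomplex R) (pseudoMetric_normed (Rcomplex R)).
HB.instance Definition _ (R : realType) := isPointed.Build (Rcomplex R) 0.
HB.instance Definition _ (R : realType) :=
  NormedZmod_PseudoMetric_eq.Build R (Rcomplex R) erefl.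

Lemma Rcomplex_normrZ (R : realType) (l : R) (z : Rcomplex R) :
  `|l *: z| = `|l| * `|z|.
Proof.
case: z => x y; rewrite /Num.norm /= !exprMn -mulrDr.
by rewrite sqrtrM ?sqr_ge0// sqrtr_sqr.
Qed.
HB.instance Definition _ (R : realType) :=
  PseudoMetricNormedZmod_Lmodule_isNormedModule.Build R (Rcomplex R)
    (@Rcomplex_normrZ R).

Variant ground_field := RealField | ComplexField.

Definition scalar_space (R : realType) (F : ground_field) : normedModType R :=
  match F with RealField => R^o | ComplexField => Rcomplex R end.

Definition scalars (R : realType) (F : ground_field) : Type := scalar_space R F.

HB.instance Definition _ (R : realType) (F : ground_field) :=
  NormedModule.copy (scalars R F) (scalar_space R F).

Section ScalarRing.
Variables (R : realType) (F : ground_field).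

Definition scalar_one : scalars R F :=
  match F with RealField => (1 : R) | ComplexField => (1 : R[i]) end.

Definition scalar_mul : scalars R F -> scalars R F -> scalars R F :=
  match F with
  | RealField => fun x y : R => x * y
  | ComplexField => fun x y : R[i] => x * y
  end.

Fact scalar_mulA : associative scalar_mul.
Proof. by rewrite /scalar_mul; case: F => x y z; exact: mulrA. Qed.
Fact scalar_mulC : commutative scalar_mul.
Proof. by rewrite /scalar_mul; case: F => x y; exact: mulrC. Qed.
Fact scalar_mul1 : left_id scalar_one scalar_mul.
Proof. by rewrite /scalar_mul /scalar_one; case: F => x; exact: mul1r. Qed.
Fact scalar_mulDl : left_distributive scalar_mul +%R.
Proof. by rewrite /scalar_mul; case: F => x y z; exact: mulrDl. Qed.
Fact scalar_one_neq0 : scalar_one != 0.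
Proof. by rewrite /scalar_one; case: F; exact: oner_neq0. Qed.

HB.instance Definition _ := GRing.Zmodule_isComNzRing.Build (scalars R F)
  scalar_mulA scalar_mulC scalar_mul1 scalar_mulDl scalar_one_neq0.
End ScalarRing.

Section Ck.
Context {R : realType} {n : nat} {W : normedModType R}.
Implicit Types (U : set 'rV[R]_n) (f : 'rV[R]_n -> W).

Fixpoint Cm_on (m : nat) U f : Prop :=
  (forall x, U x -> {for x, continuous f}) /\
  if m is m'.+1 then
    forall j : 'I_n, let e_j : 'rV[R]_n := delta_mx 0 j in
      (forall x, U x -> derivable f x e_j) /\ Cm_on m' U ('D_e_j f)
  else True.

(* Differentiability classes are indexed by [option nat], [None] being the
   class of smooth functions. *)
Definition Ck_on (k : option nat) U f : Prop :=
  if k is Some m then Cm_on m U f else forall m, Cm_on m U f.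
End Ck.

(* A homeomorphism from an open subset of M onto an open subset of R^n. The maps
   in both directions are total; their values outside [chart_dom] and
   [chart_codom] are irrelevant. *)
Record chart (R : realType) (n : nat) (M : topologicalType) := Chart {
  chart_dom : set M;
  chart_codom : set 'rV[R]_n;
  chart_map : M -> 'rV[R]_n;
  chart_inv : 'rV[R]_n -> M;
  chart_dom_open : open chart_dom;
  chart_codom_open : open chart_codom;
  chart_map_fun : forall x, chart_dom x -> chart_codom (chart_map x);
  chart_inv_fun : forall y, chart_codom y -> chart_dom (chart_inv y);
  chart_mapK : forall x, chart_dom x -> chart_inv (chart_map x) = x;
  chart_invK : forall y, chart_codom y -> chart_map (chart_inv y) = y;
  chart_map_continuous : forall x, chart_dom x -> {for x, continuous chart_map};
  chart_inv_continuous :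
    forall y, chart_codom y -> {for y, continuous chart_inv}
}.

Record Ck_manifold (R : realType) (k : option nat) (n : nat) := CkManifold {
  carrier :> topologicalType;
  carrier_hausdorff : hausdorff_space carrier;
  carrier_second_countable : @second_countable carrier;
  atlas : set (chart R n carrier);
  atlas_cover : forall x, exists2 c, atlas c & chart_dom c x;
  atlas_compat : forall c d, atlas c -> atlas d ->
    Ck_on k (chart_map c @` (chart_dom c `&` chart_dom d))
      (chart_map d \o chart_inv c)
}.

Arguments atlas {R k n} _.

Section RichSubspace.
Context {R : realType} {F : ground_field} {k : option nat} {n : nat}.
Variable M : Ck_manifold R k n.

Definition Ck_functions : set (M -> scalars R F) :=
  [set f : M -> scalars R F |
    forall c, atlas M c -> Ck_on k (chart_codom c) (f \o chart_inv c)].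

Record linear_subspace (E : set (M -> scalars R F)) : Prop := LinearSubspace {
  subspace_zero : E (fun=> 0);
  subspace_add : forall f g, E f -> E g -> E (f \+ g);
  subspace_scale : forall (c : scalars R F) f, E f -> E (fun x => c * f x)
}.

Record rich_subspace (E : set (M -> scalars R F)) : Prop := RichSubspace {
  rich_linear : linear_subspace E;
  rich_Ck : E `<=` Ck_functions;
  rich_mul : forall f g, E f -> E g -> E (f \* g);
  rich_large : forall (x : M) (r : R), 0 < r -> exists2 h, E h & r < `|h x|
}.
End RichSubspace.

(* Main.v *)
(* The operator [T] satisfies
   [(T (f g) - T f * T g) T h = (T (f g) T h - T (f g h)) + (T (f g h) - T f T (g h))
                              + T f (T (g h) - T g T h)],
   so the left-hand side is bounded by [(2 + |T f|) a] pointwise, uniformly in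
   [h]. By surjectivity and richness [T h] is arbitrarily large at any given
   point, so the first factor vanishes there (Baker's superstability argument). *)
Require Import Defs.
From mathcomp Require Import all_boot all_order all_algebra.
From mathcomp Require Import complex.
From mathcomp Require Import all_classical all_reals all_analysis.
Import Order.TTheory GRing.Theory Num.Theory.
Import numFieldNormedType.Exports.
Local Open Scope classical_set_scope.
Local Open Scope ring_scope.

Lemma scalar_normM (R : realType) (F : ground_field) (x y : scalars R F) :
  `|x * y| = `|x| * `|y|.
Proof.
case: F x y => x y; first exact: (@normrM R).
exact: (@Normc.normcM R).
Qed.

Lemma eq0_of_bounded_multiples (R : realFieldType) (u C : R) :
  0 <= u -> (forall r, 0 < r -> exists2 s, r < s & u * s <= C) -> u = 0.
Proof.
move=> u_ge0 bnd; apply/eqP; rewrite eq_le u_ge0 andbT leNgt.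
apply/negP => u_gt0.
(* The absolute value and the [+ 1] keep the threshold positive whatever the sign of [C], also for
   [C = 0]. *)
have [s lts] := bnd (`|C| / u + 1) ltac:(by rewrite ltr_wpDl ?divr_ge0).
apply/negP; rewrite -ltNge mulrC -ltr_pdivrMr//.
apply: le_lt_trans lts; apply: (@le_trans _ _ (`|C| / u)); last by rewrite lerDl.
by rewrite ler_pM2r ?invr_gt0// ler_norm.
Qed.

Theorem proposition1 (R : realType) (F : ground_field) (k : option nat)
    (n : nat) (M : Ck_manifold R k n) (E : set (M -> scalars R F))
    (richE : rich_subspace E) (a : M -> R) (a_gt0 : forall x, 0 < a x)
    (T : (M -> scalars R F) -> (M -> scalars R F)) (bijT : set_bij E E T)
    (almost_mult : forall f g, E f -> E g -> forall x : M,
       `|T (f \* g) x - T f x * T g x| <= a x) :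
  forall f g, E f -> E g -> T (f \* g) = T f \* T g.
Proof.
move=> f g Ef Eg; apply/funext => x.
apply/eqP; rewrite -subr_eq0 -normr_eq0; apply/eqP.
apply: (@eq0_of_bounded_multiples _ _ ((2 + `|T f x|) * a x)) => // r r_gt0.
have [h' Eh' rh'] := rich_large richE x r_gt0.
have [_ _ /(_ _ Eh')[h Eh Th]] := bijT.
exists `|T h x|; first by rewrite Th.
have Efg := rich_mul richE Ef Eg; have Egh := rich_mul richE Eg Eh.
have mulA : (f \* g) \* h = f \* (g \* h).
  by apply/funext => y /=; rewrite mulrA.
have B1 := almost_mult _ _ Efg Eh x.
have B2 := almost_mult _ _ Ef Egh x.
have B3 := almost_mult _ _ Eg Eh x.
(* After reassociation [B1] and [B2] involve the same value [t], which can then cancel. *)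
rewrite mulA in B1; rewrite -scalar_normM /=.
set t := T (f \* (g \* h)) x in B1 B2.
have -> : (T (f \* g) x - T f x * T g x) * T h x =
    (T (f \* g) x * T h x - t) + (t - T f x * T (g \* h) x)
    + T f x * (T (g \* h) x - T g x * T h x).
  by rewrite mulrBl mulrBr addrA (addrA _ t) !subrK mulrA.
(* One [a x] each for the summands bounded by [B1] and [B2]; the factor [T f x] scales the bound
   [B3]. *)
rewrite mulrDl (mulr_natl (a x) 2) mulr2n.
apply: (le_trans (ler_normD _ _)); apply: lerD.
  by apply: (le_trans (ler_normD _ _)); apply: lerD; rewrite // distrC.
by rewrite scalar_normM ler_wpM2l.
Qed.
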